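(* Assume $f_1,\dots,f_m$ are general convex functions ($\mu=0$, $M>0$). Let $\mathbf{x}^*$ be an optimal solution of (P), and let $\mathbf{y}^*$ be such that $(\mathbf{x}^*,\mathbf{y}^* )$ is a saddle point of (SP). Let $N\ge1$, $\tilde D>0$, and run the DCS method with $\lambda_t=t+1$, $\beta_t=t/2$ for all $t\ge1$, and $$\alpha_k=\theta_k=1,\quad \eta_k=2\|\mathbf{L}\|,\quad \tau_k=\|\mathbf{L}\|,\quad T_k=\left\lceil\frac{mM^2N}{\|\mathbf{L}\|^2\tilde D}\right\rceil,\qquad k=1,\dots,N.$$ Then $\hat{\mathbf{x}}^N_{\mathrm{avg}}:=\frac1N\sum_{k=1}^N\hat{\mathbf{x}}^k$ satisfies $$F(\hat{\mathbf{x}}^N_{\mathrm{avg}})-F(\mathbf{x}^* )\le\frac{\|\mathbf{L}\|}{N}\Big[3\mathbf{V}(\mathbf{x}^0,\mathbf{x}^* )+\tfrac12\|\mathbf{y}^0\|^2+2\tilde D\Big]$$ and $$\|\mathbf{L}\hat{\mathbf{x}}^N_{\mathrm{avg}}\|\le\frac{\|\mathbf{L}\|}{N}\Big[3\sqrt{6\mathbf{V}(\mathbf{x}^0,\mathbf{x}^* )+4\tilde D}+4\|\mathbf{y}^*-\mathbf{y}^0\|\Big].$$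
   Context: Setting. Let $m\ge 2$, $d\ge 1$, and let $\mathcal{G}=([m],\mathcal{E})$ be a connected undirected graph. Put $N_i=\{j:(i,j)\in\mathcal{E}\}\cup\{i\}$. The Laplacian $L\in\mathbb{R}^{m\times m}$ has $L_{ii}=|N_i|-1$, $L_{ij}=-1$ if $i\ne j$ and $(i,j)\in\mathcal{E}$, and $L_{ij}=0$ otherwise; $\mathbf{L}=L\otimes I_d$. For each $i\in[m]$, $X_i\subseteq\mathbb{R}^d$ is closed convex and $\bigcap_i X_i\neq\emptyset$; $\|\cdot\|_{X_i}$ is a norm on $\mathbb{R}^d$; $f_i:X_i\to\mathbb{R}$ is convex, with subgradients $f_i'(y)\in\partial f_i(y)$ satisfying $\frac{\mu}{2}\|x-y\|_{X_i}^2\le f_i(x)-f_i(y)-\langle f_i'(y),x-y\rangle\le M\|x-y\|_{X_i}$ for all $x,y\in X_i$. Prox-functions. $\omega_i:X_i\to\mathbb{R}$ is continuously differentiable with $\langle\nabla\omega_i(x)-\nabla\omega_i(u),x-u\rangle\ge\|x-u\|_{X_i}^2$, and $V_i(x,u)=\omega_i(u)-\omega_i(x)-\langle\nabla\omega_i(x),u-x\rangle$. Write $X^m=X_1\times\dots\times X_m$, $\mathbf{x}=(x_1,\dots,x_m)$, $\|\mathbf{x}\|^2=\sum_i\|x_i\|_{X_i}^2$ for primal vectors, $\mathbf{V}(\mathbf{x},\mathbf{u})=\sum_iV_i(x_i,u_i)$. Dual vectors $\mathbf{y}\in\mathbb{R}^{md}$ and vectors $\mathbf{L}\mathbf{x}$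 are measured in the Euclidean norm, and $\|\mathbf{L}\|$ is the operator norm from the primal norm to the Euclidean norm. Problem. (P): minimize $F(\mathbf{x})=\sum_{i=1}^mf_i(x_i)$ subject to $\mathbf{L}\mathbf{x}=\mathbf{0}$, $\mathbf{x}\in X^m$. (SP): $\min_{\mathbf{x}\in X^m}\big[F(\mathbf{x})+\max_{\mathbf{y}\in\mathbb{R}^{md}}\langle\mathbf{L}\mathbf{x},\mathbf{y}\rangle\big]$. It is assumed that there are an optimal solution $\mathbf{x}^*$ of (P) and $\mathbf{y}^*\in\mathbb{R}^{md}$ such that $(\mathbf{x}^*,\mathbf{y}^* )$ is a saddle point of (SP). DCS method. Given $\mathbf{x}^0=\mathbf{x}^{-1}=\hat{\mathbf{x}}^0\in X^m$, $\mathbf{y}^0\in\mathbb{R}^{md}$, parameters $\alpha_k,\tau_k,\eta_k$, positive integers $T_k$, and inner parameters $\lambda_t,\beta_t$ (the $\theta_k$ are averaging weights), for $k=1,\dots,N$ set $\tilde{\mathbf{x}}^k=\alpha_k(\hat{\mathbf{x}}^{k-1}-\mathbf{x}^{k-2})+\mathbf{x}^{k-1}$; $\mathbf{y}^k=\mathbf{y}^{k-1}+\frac1{\tau_k}\mathbf{L}\tilde{\mathbf{x}}^k$; $\mathbf{w}^k=(w_1^k,\dots,w_m^k)=\mathbf{L}\mathbf{y}^k$; and for each $i\in[m]$: $u_i^{0,k}=x_i^{k-1}$; for $t=1,\dots,T_k$, $h_i^{t-1,k}=f_i'(u_i^{t-1,k})$ and $u_i^{t,k}=\arg\min_{u\in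 X_i}\big[\langle w_i^k+h_i^{t-1,k},u\rangle+\eta_kV_i(x_i^{k-1},u)+\eta_k\beta_tV_i(u_i^{t-1,k},u)\big]$; then $x_i^k=u_i^{T_k,k}$ and $\hat x_i^k=\big(\sum_{t=1}^{T_k}\lambda_t\big)^{-1}\sum_{t=1}^{T_k}\lambda_tu_i^{t,k}$. *)

(* Defs.v *)
From mathcomp Require Import all_boot all_order all_algebra.
From mathcomp Require Import mxtens.
From mathcomp Require Import all_classical all_reals all_analysis.
Set Implicit Arguments.
Unset Strict Implicit.
Unset Printing Implicit Defensive.
Import Order.TTheory GRing.Theory Num.Theory.
Import numFieldNormedType.Exports.
Local Open Scope classical_set_scope.
Local Open Scope ring_scope.

Section Euclidean.
Context {R : realType}.

Definition dotp n (u v : 'cV[R]_n) : R := \sum_(j < n) u j 0 * v j 0.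

Definition enorm n (u : 'cV[R]_n) : R := Num.sqrt (dotp u u).

Record is_norm n (nu : 'cV[R]_n -> R) : Prop := {
  norm_triangle : forall u v, nu (u + v) <= nu u + nu v;
  norm_scale : forall (a : R) u, nu (a *: u) = `|a| * nu u;
  norm_definite : forall u, nu u = 0 -> u = 0 }.

(* A minimizer of phi over X; values of phi outside X are irrelevant. *)
Definition is_argmin n (X : set 'cV[R]_n) (phi : 'cV[R]_n -> R)
    (u : 'cV[R]_n) : Prop :=
  X u /\ forall v, X v -> phi u <= phi v.

(* The subdifferential at y of a function defined on X only, i.e. that of its
   extension by +oo outside X. *)
Definition subdifferential n (X : set 'cV[R]_n) (f : 'cV[R]_n -> R)
    (y : 'cV[R]_n) : set 'cV[R]_n :=
  [set g | forall x, X x -> f y + dotp g (x - y) <= f x].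

Definition subgradient_bounds n (X : set 'cV[R]_n) (nu : 'cV[R]_n -> R)
    (mu M : R) (f : 'cV[R]_n -> R) (f' : 'cV[R]_n -> 'cV[R]_n) : Prop :=
  forall x y, X x -> X y ->
    mu / 2 * nu (x - y) ^+ 2 <= f x - f y - dotp (f' y) (x - y)
      <= M * nu (x - y).

(* omega is continuously differentiable on X with gradient g.  Only values on X
   matter: continuity and the first-order expansion are relative to X, which may
   be without interior. *)
Definition C1_on n (X : set 'cV[R]_n) (omega : 'cV[R]_n -> R)
    (g : 'cV[R]_n -> 'cV[R]_n) : Prop :=
  {within X, continuous g} /\
  forall x, X x -> forall eps : R, 0 < eps ->
    \forall y \near x, X y ->
      `|omega y - omega x - dotp (g x) (y - x)| <= eps * enorm (y - x).

Definition prox n (omega : 'cV[R]_n -> R) (g : 'cV[R]_n -> 'cV[R]_n)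
    (x u : 'cV[R]_n) : R :=
  omega u - omega x - dotp (g x) (u - x).

End Euclidean.

Section Network.
Context {R : realType} {m : nat}.

Definition nbh (e : rel 'I_m) (i : 'I_m) : {set 'I_m} :=
  (i |: [set j | e i j])%SET.

Definition laplacian (e : rel 'I_m) : 'M[R]_m :=
  \matrix_(i, j) if i == j then #|nbh e i|%:R - 1
                 else if e i j then -1 else 0.

Definition biglaplacian (d : nat) (e : rel 'I_m) : 'M[R]_(m * d) :=
  laplacian e *t (1%:M : 'M[R]_d).

Context {d : nat}.

(* The component x_i in R^d of x = (x_1, ..., x_m) in R^(md); the indexing is
   the one used by the Kronecker product *t. *)
Definition blk (x : 'cV[R]_(m * d)) (i : 'I_m) : 'cV[R]_d :=
  \col_j x (mxtens_index (i, j)) 0.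

Definition prodset (X : 'I_m -> set 'cV[R]_d) : set 'cV[R]_(m * d) :=
  [set x | forall i, X i (blk x i)].

Definition Fsum (f : 'I_m -> 'cV[R]_d -> R) (x : 'cV[R]_(m * d)) : R :=
  \sum_i f i (blk x i).

Definition Vsum (V : 'I_m -> 'cV[R]_d -> 'cV[R]_d -> R)
    (x u : 'cV[R]_(m * d)) : R :=
  \sum_i V i (blk x i) (blk u i).

Definition pnorm (nu : 'I_m -> 'cV[R]_d -> R) (x : 'cV[R]_(m * d)) : R :=
  Num.sqrt (\sum_i nu i (blk x i) ^+ 2).

Definition opnorm (nu : 'I_m -> 'cV[R]_d -> R) (L : 'M[R]_(m * d)) : R :=
  sup [set enorm (L *m x) | x in [set x | pnorm nu x <= 1]].

Definition optimal_solution (L : 'M[R]_(m * d)) (X : 'I_m -> set 'cV[R]_d)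
    (f : 'I_m -> 'cV[R]_d -> R) (xs : 'cV[R]_(m * d)) : Prop :=
  is_argmin (prodset X `&` [set x | L *m x = 0]) (Fsum f) xs.

Definition saddle_point (L : 'M[R]_(m * d)) (X : 'I_m -> set 'cV[R]_d)
    (f : 'I_m -> 'cV[R]_d -> R) (xs ys : 'cV[R]_(m * d)) : Prop :=
  prodset X xs /\
  forall x y, prodset X x ->
    Fsum f xs + dotp (L *m xs) y <= Fsum f xs + dotp (L *m xs) ys
      <= Fsum f x + dotp (L *m x) ys.

(* The sequences x^k, xhat^k, y^k (0 <= k <= N) and u_i^{t,k} are produced by
   N iterations of the DCS method.  The initial point x^{-1} = x^0 is encoded
   by truncated predecessors: x k.-2 is x^{k-2} for k >= 2, and x^0 for k = 1. *)
Record DCS (L : 'M[R]_(m * d)) (X : 'I_m -> set 'cV[R]_d)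
    (f' : 'I_m -> 'cV[R]_d -> 'cV[R]_d)
    (V : 'I_m -> 'cV[R]_d -> 'cV[R]_d -> R)
    (alpha tau eta : nat -> R) (T : nat -> nat) (lambda beta : nat -> R)
    (N : nat) (x xhat y : nat -> 'cV[R]_(m * d))
    (u : 'I_m -> nat -> nat -> 'cV[R]_d) : Prop := {
  DCS_init : prodset X (x 0%N) /\ xhat 0%N = x 0%N;
  DCS_dual : forall k, (1 <= k <= N)%N ->
    let xtilde := alpha k *: (xhat k.-1 - x k.-2) + x k.-1 in
    y k = y k.-1 + (tau k)^-1 *: (L *m xtilde);
  DCS_inner_init : forall k i, (1 <= k <= N)%N -> u i 0%N k = blk (x k.-1) i;
  DCS_inner : forall k i t, (1 <= k <= N)%N -> (1 <= t <= T k)%N ->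
    let w := L *m y k in
    let h := f' i (u i t.-1 k) in
    is_argmin (X i)
      (fun v => dotp (blk w i + h) v + eta k * V i (blk (x k.-1) i) v
                + eta k * beta t * V i (u i t.-1 k) v)
      (u i t k);
  DCS_last : forall k i, (1 <= k <= N)%N -> blk (x k) i = u i (T k) k;
  DCS_avg : forall k i, (1 <= k <= N)%N ->
    blk (xhat k) i = (\sum_(1 <= t < (T k).+1) lambda t)^-1 *:
                     \sum_(1 <= t < (T k).+1) lambda t *: u i t k }.

End Network.

(* Main.v *)
Require Import Defs.
From HB Require Import structures.
From mathcomp Require Import all_boot all_order all_algebra.
From mathcomp Require Import mxtens.
From mathcomp Require Import all_classical all_reals all_analysis.
From mathcomp Require Import ring lra zify.
Set Implicit Arguments.
Unset Strict Implicit.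
Unset Printing Implicit Defensive.
Import Order.TTheory GRing.Theory Num.Theory.
Import numFieldNormedType.Exports.
Local Open Scope classical_set_scope.
Local Open Scope ring_scope.

(* In each inner loop the three-point property of the prox step, the bound
   M nu(d) <= (eta t/4) nu(d)^2 + M^2/(eta t) and the weights t + 1, for which
   (t + 1)(1 + t/2) = (t + 2)(t + 1)/2, make the Bregman terms telescope.  In the
   outer loop the dual steps telescope up to the errors L(xhat^k - x^(k-1)), which
   are absorbed by the terms 2 |L| V(x^(k-1), xhat^k).  This bounds, for every z,
   N (F(xavg) - F(xs) + <L xavg, z>) by
   |L| (3 V(x^0, xs) + |z - y^0|^2 / 2 + 2 Dt).  The first claim is z = 0; the
   second takes z to be ys plus a multiple of L xavg, since
   F(xavg) - F(xs) + <L xavg, ys> >= 0 at a saddle point. *)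

(** * Euclidean inner product and norm *)

Section InnerProduct.
Context {R : realType} {n : nat}.
Implicit Types (u v w : 'cV[R]_n) (a : R).

Lemma dotpC u v : dotp u v = dotp v u.
Proof. by apply: eq_bigr => j _; rewrite mulrC. Qed.

Lemma dotpDr u v w : dotp u (v + w) = dotp u v + dotp u w.
Proof. by rewrite -big_split; apply: eq_bigr => j _; rewrite mxE mulrDr. Qed.

Lemma dotpZr a u v : dotp u (a *: v) = a * dotp u v.
Proof.
by rewrite /dotp big_distrr; apply: eq_bigr => j _; rewrite /= mxE mulrCA.
Qed.

Lemma dotpDl u v w : dotp (u + v) w = dotp u w + dotp v w.
Proof. by rewrite dotpC dotpDr !(dotpC w). Qed.

Lemma dotpZl a u v : dotp (a *: u) v = a * dotp u v.
Proof. by rewrite dotpC dotpZr dotpC. Qed.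

Lemma dotpNr u v : dotp u (- v) = - dotp u v.
Proof. by rewrite -scaleN1r dotpZr mulN1r. Qed.

Lemma dotpNl u v : dotp (- u) v = - dotp u v.
Proof. by rewrite dotpC dotpNr dotpC. Qed.

Lemma dotp0r u : dotp u 0 = 0.
Proof. by rewrite -(scale0r (0 : 'cV[R]_n)) dotpZr mul0r. Qed.

Lemma dotp0l u : dotp 0 u = 0.
Proof. by rewrite dotpC dotp0r. Qed.

Definition dotpE :=
  (dotpDr, dotpDl, dotpNr, dotpNl, dotpZr, dotpZl, dotp0r, dotp0l).

Lemma dotp_sumr (I : Type) (r : seq I) (P : pred I) u (F : I -> 'cV[R]_n) :
  dotp u (\sum_(i <- r | P i) F i) = \sum_(i <- r | P i) dotp u (F i).
Proof. exact: (big_morph (dotp u) (dotpDr u) (dotp0r u)). Qed.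

Lemma dotp_ge0 u : 0 <= dotp u u.
Proof. by apply: sumr_ge0 => j _; rewrite -expr2 sqr_ge0. Qed.

Lemma dotp_eq0 u : dotp u u = 0 -> u = 0.
Proof.
move=> /eqP; rewrite psumr_eq0; last by move=> j _; rewrite -expr2 sqr_ge0.
move=> /allP h; apply/colP => j; rewrite mxE.
by have := h j (mem_index_enum j); rewrite mulf_eq0 orbb => /eqP.
Qed.

Lemma enorm_ge0 u : 0 <= enorm u.
Proof. exact: sqrtr_ge0. Qed.

Lemma enorm_sqr u : enorm u ^+ 2 = dotp u u.
Proof. by rewrite sqr_sqrtr // dotp_ge0. Qed.

Lemma enorm0 : enorm (0 : 'cV[R]_n) = 0.
Proof. by rewrite /enorm dotp0r sqrtr0. Qed.

Lemma enormZ a u : enorm (a *: u) = `|a| * enorm u.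
Proof.
by rewrite /enorm dotpZr dotpZl mulrA -expr2 sqrtrM ?sqr_ge0 // sqrtr_sqr.
Qed.

(** Nonnegativity of the squared norm of [enorm v *: u - enorm u *: v], a positive multiple of the
    difference of the two sides unless one of the vectors is zero. *)
Lemma dotp_le_enorm u v : dotp u v <= enorm u * enorm v.
Proof.
have := enorm_ge0 u; rewrite le_eqVlt => /predU1P[u0|u_gt0].
  have /dotp_eq0 -> : dotp u u = 0 by rewrite -enorm_sqr -u0 expr0n.
  by rewrite dotp0l mulr_ge0 // enorm_ge0.
have := enorm_ge0 v; rewrite le_eqVlt => /predU1P[v0|v_gt0].
  have /dotp_eq0 -> : dotp v v = 0 by rewrite -enorm_sqr -v0 expr0n.
  by rewrite dotp0r mulr_ge0 // enorm_ge0.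
have E : dotp (enorm v *: u - enorm u *: v) (enorm v *: u - enorm u *: v)
    = (2 * enorm u * enorm v) * (enorm u * enorm v - dotp u v).
  by rewrite !dotpE (dotpC v u) -!enorm_sqr; ring.
have := dotp_ge0 (enorm v *: u - enorm u *: v).
by rewrite E pmulr_rge0 ?subr_ge0 // !mulr_gt0.
Qed.

Lemma enormD u v : enorm (u + v) <= enorm u + enorm v.
Proof.
rewrite -(@ler_pXn2r _ 2) ?nnegrE ?addr_ge0 ?enorm_ge0 //.
rewrite enorm_sqr sqrrD !enorm_sqr !dotpE (dotpC v u).
have := dotp_le_enorm u v; lra.
Qed.

Lemma enorm_is_norm : is_norm (@enorm R n).
Proof.
split; [exact: enormD | exact: enormZ |].
by move=> u u0; apply: dotp_eq0; rewrite -enorm_sqr u0 expr0n.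
Qed.

Lemma dotp_young a u v : 2 * a * dotp u v <= dotp u u + a ^+ 2 * dotp v v.
Proof. by have := dotp_ge0 (u - a *: v); rewrite !dotpE (dotpC v u); lra. Qed.

End InnerProduct.

Lemma dotp_sym_mul {R : realType} {n : nat} (A : 'M[R]_n) (u v : 'cV[R]_n) :
  A^T = A -> dotp (A *m u) v = dotp u (A *m v).
Proof.
have dotp_mx (a b : 'cV[R]_n) : dotp a b = (a^T *m b) 0 0.
  by rewrite mxE; apply: eq_bigr => j _; rewrite mxE.
by move=> symA; rewrite !dotp_mx trmx_mul symA mulmxA.
Qed.

(** * Consequences of the norm axioms *)

Section Norms.
Context {R : realType} {n : nat} {nu : 'cV[R]_n -> R}.
Hypothesis nuN : is_norm nu.
Implicit Types (u v : 'cV[R]_n).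

Lemma is_norm0 : nu 0 = 0.
Proof. by rewrite -(scale0r (0 : 'cV[R]_n)) (norm_scale nuN) normr0 mul0r. Qed.

Lemma is_normN u : nu (- u) = nu u.
Proof. by rewrite -scaleN1r (norm_scale nuN) normrN1 mul1r. Qed.

Lemma is_norm_ge0 u : 0 <= nu u.
Proof.
have := norm_triangle nuN u (- u); rewrite subrr is_norm0 is_normN.
by rewrite -mulr2n pmulrn_lge0.
Qed.

Lemma is_norm_sum (I : Type) (r : seq I) (F : I -> 'cV[R]_n) :
  nu (\sum_(i <- r) F i) <= \sum_(i <- r) nu (F i).
Proof.
elim: r => [|i r IH]; first by rewrite !big_nil is_norm0.
rewrite !big_cons; apply: le_trans (norm_triangle nuN _ _) _.
by rewrite lerD2l.
Qed.

Lemma is_norm_dist u v : `|nu u - nu v| <= nu (u - v).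
Proof.
have h a b : nu a - nu b <= nu (a - b).
  by rewrite lerBlDr -[in leLHS](subrK b a); exact: (norm_triangle nuN).
rewrite ler_norml h andbT lerNl opprB; apply: le_trans (h v u) _.
by rewrite -(opprB u v) is_normN.
Qed.

Lemma col_delta_sum u : u = \sum_(j < n) u j 0 *: delta_mx j 0.
Proof.
by rewrite {1}(matrix_sum_delta u); apply: eq_bigr => j _; rewrite big_ord1.
Qed.

Lemma is_norm_le_coord u : nu u <= \sum_(j < n) `|u j 0| * nu (delta_mx j 0).
Proof.
rewrite [u in leLHS]col_delta_sum. apply: le_trans (is_norm_sum _ _) _.
by apply: ler_sum => j _; rewrite (norm_scale nuN).
Qed.

End Norms.

(** * Comparison of an arbitrary norm with the coordinates *)

Section NormEquivalence.
Context {R : realType} {n : nat}.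

Lemma coord_le_mxnorm (v : 'rV[R]_n) j : `|v 0 j| <= `|v|.
Proof.
rewrite [leRHS]/Num.norm /= mx_normrE.
exact: (le_bigmax _ (fun ij : 'I_1 * 'I_n => `|v ij.1 ij.2|) (0, j)).
Qed.

(** The reverse triangle inequality makes [nu] Lipschitz for the maximum norm, with constant [K].
    The transpose moves [nu] to row vectors, where the compactness argument below takes place. *)
Lemma is_norm_continuous (nu : 'cV[R]_n -> R) :
  is_norm nu -> continuous (fun v : 'rV[R]_n => nu v^T).
Proof.
move=> nuN; pose K := \sum_(j < n) nu (delta_mx j 0).
have K_ge0 : 0 <= K by apply: sumr_ge0 => j _; exact: is_norm_ge0.
have nu_le (v : 'rV[R]_n) : nu v^T <= `|v| * K.
  apply: le_trans (is_norm_le_coord nuN _) _.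
  rewrite big_distrr; apply: ler_sum => j _ /=.
  by rewrite ler_wpM2r ?(is_norm_ge0 nuN) // mxE coord_le_mxnorm.
move=> v; apply/(@cvgrPdist_le _ _ _ _ (nbhs_filter v)) => eps eps_gt0.
have K1 : 0 < K + 1 by rewrite ltr_wpDl.
have near_v : \forall w \near v, `|v - w| <= eps / (K + 1).
  apply: (@cvgr_dist_le _ _ _ _ (nbhs_filter v) id); first exact: cvg_id.
  by rewrite divr_gt0.
apply: filterS near_v => w vw; apply: le_trans (is_norm_dist nuN _ _) _.
rewrite -linearB; apply: le_trans (nu_le _) _.
rewrite (@le_trans _ _ (`|v - w| * (K + 1))) //.
  by rewrite ler_wpM2l // lerDl.
by rewrite -ler_pdivlMr.
Qed.

(** By compactness [nu] attains a minimum on the unit sphere of the maximum norm. It is positive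
    because [nu] is definite, and by homogeneity its inverse serves as [c]. *)
Lemma norm_coord_bound (nu : 'cV[R]_n -> R) : is_norm nu ->
  exists2 c : R, 0 < c & forall (u : 'cV_n) j, `|u j 0| <= c * nu u.
Proof.
move=> nuN; pose S := [set v : 'rV[R]_n | `|v| = 1].
have scaleS (v : 'rV[R]_n) : v != 0 -> S (`|v|^-1 *: v).
  move=> v0; rewrite /S /= normrZ normfV normr_id mulVf //.
  by rewrite normr_eq0.
(* If the sphere is empty, every vector is zero and any constant works. *)
have [[v Sv]|S0] := pselect (S !=set0); last first.
  exists 1 => // u j; suff -> : u = 0 by rewrite mxE normr0 (is_norm0 nuN) mulr0.
  apply/eqP; rewrite -(inj_eq trmx_inj) trmx0; apply: contra_notT S0 => u0.
  by exists (`|u^T|^-1 *: u^T); exact: scaleS.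
have cS : compact S.
  apply: bounded_closed_compact.
    by exists 1; split=> // M M1 w /= ->; exact: ltW.
  have -> : S = (fun v => `|v|) @^-1` [set (1 : R)] by [].
  apply: preimage_closed; last exact: closed_eq.
  by move=> w _; exact: norm_continuous.
have cnu : {within S, continuous (fun v : 'rV[R]_n => nu v^T)}.
  by apply: continuous_subspaceT; exact: is_norm_continuous.
have [w Sw w_min] := compact_EVT_min (ex_intro _ v Sv) cS cnu.
have w_gt0 : 0 < nu w^T.
  rewrite lt_neqAle (is_norm_ge0 nuN) andbT eq_sym; apply/eqP => w0.
  have /(congr1 trmx) := norm_definite nuN w0.
  rewrite trmxK trmx0 => w00.
  move: Sw; rewrite inE /S /= w00 normr0 => /esym /eqP.
  by rewrite oner_eq0.
exists (nu w^T)^-1 => [|u j]; first by rewrite invr_gt0.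
apply: (@le_trans _ _ `|u^T|); first by have := coord_le_mxnorm u^T j; rewrite mxE.
rewrite mulrC ler_pdivlMr //.
have [->|u0] := eqVneq u 0; first by rewrite trmx0 normr0 mul0r (is_norm0 nuN).
have uT0 : u^T != 0 by rewrite -trmx0 (inj_eq trmx_inj).
have := w_min _ (mem_set (scaleS _ uT0)).
rewrite linearZ /= trmxK (norm_scale nuN) normfV normr_id.
rewrite mulrC ler_pdivlMr; first by rewrite mulrC.
by rewrite normr_gt0.
Qed.

End NormEquivalence.

(** * Block vectors *)

Section Blocks.
Context {R : realType} {m d : nat}.
Implicit Types (x y : 'cV[R]_(m * d)) (i : 'I_m).

Lemma blkD x y i : blk (x + y) i = blk x i + blk y i.
Proof. by apply/colP => j; rewrite !mxE. Qed.

Lemma blkZ (a : R) x i : blk (a *: x) i = a *: blk x i.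
Proof. by apply/colP => j; rewrite !mxE. Qed.

Lemma blkN x i : blk (- x) i = - blk x i.
Proof. by apply/colP => j; rewrite !mxE. Qed.

Lemma blk_sum (I : Type) (r : seq I) (P : pred I) (F : I -> 'cV[R]_(m * d)) i :
  blk (\sum_(k <- r | P k) F k) i = \sum_(k <- r | P k) blk (F k) i.
Proof.
apply: (big_morph (blk^~ i)) => [x y|]; first exact: blkD.
by apply/colP => j; rewrite !mxE.
Qed.

Lemma dotp_blk x y : dotp x y = \sum_i dotp (blk x i) (blk y i).
Proof.
rewrite pair_big /= /dotp.
rewrite (reindex (fun ij : 'I_m * 'I_d => mxtens_index ij)) /=.
  by apply: eq_bigr => -[i j] _; rewrite !mxE.
by exists (@mxtens_unindex m d) => k _; rewrite (mxtens_indexK, mxtens_unindexK).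
Qed.

End Blocks.

(** * The operator norm from the primal norm to the Euclidean norm *)

Section OperatorNorm.
Context {R : realType} {m d : nat}.
Context {nu : 'I_m -> 'cV[R]_d -> R}.
Hypothesis nuN : forall i, is_norm (nu i).
Implicit Types (x y : 'cV[R]_(m * d)) (i : 'I_m) (L : 'M[R]_(m * d)).

Lemma pnorm_sqr x : pnorm nu x ^+ 2 = \sum_i nu i (blk x i) ^+ 2.
Proof. by rewrite sqr_sqrtr // sumr_ge0 // => i _; rewrite sqr_ge0. Qed.

Lemma pnorm_ge0 x : 0 <= pnorm nu x.
Proof. exact: sqrtr_ge0. Qed.

Lemma pnormZ (a : R) x : pnorm nu (a *: x) = `|a| * pnorm nu x.
Proof.
rewrite /pnorm -sqrtr_sqr -sqrtrM ?sqr_ge0 // big_distrr /=.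
congr Num.sqrt; apply: eq_bigr => i _.
by rewrite blkZ (norm_scale (nuN i)) exprMn real_normK ?num_real.
Qed.

Lemma pnorm0 : pnorm nu 0 = 0.
Proof. by rewrite -(scale0r (0 : 'cV[R]_(m * d))) pnormZ normr0 mul0r. Qed.

Lemma nu_blk_le_pnorm x i : nu i (blk x i) <= pnorm nu x.
Proof.
rewrite -(@ler_pXn2r _ 2) ?nnegrE ?pnorm_ge0 ?(is_norm_ge0 (nuN i)) //.
rewrite pnorm_sqr (bigD1 i) //= lerDl sumr_ge0 // => j _.
exact: sqr_ge0.
Qed.

Lemma coord_pnorm_bound :
  exists2 c : R, 0 < c & forall x k, `|x k 0| <= c * pnorm nu x.
Proof.
have /choice[c hc] : forall i, exists c : R, 0 < c /\
    forall (u : 'cV_d) j, `|u j 0| <= c * nu i u.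
  by move=> i; have [c c0 h] := norm_coord_bound (nuN i); exists c.
have c_ge0 i : 0 <= c i by rewrite ltW ?(hc i).1.
exists (1 + \sum_i c i) => [|x k]; first by rewrite ltr_pwDl ?sumr_ge0.
case: (mxtens_indexP k) => i j.
have := (hc i).2 (blk x i) j; rewrite mxE => /le_trans; apply.
rewrite ler_pM ?(is_norm_ge0 (nuN i)) ?nu_blk_le_pnorm //.
by rewrite (bigD1 i) //= addrCA lerDl addr_ge0 // sumr_ge0.
Qed.

(** Makes the [sup] in [opnorm] a genuine supremum rather than a default value: [x] expands in unit
    vectors with coordinates at most [c] on the unit ball. *)
Lemma opnorm_has_sup L :
  has_sup [set enorm (L *m x) | x in [set x | pnorm nu x <= 1]].
Proof.
split.
  by exists (enorm (L *m 0)); exists 0; rewrite //= pnorm0 ler01.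
have [c c_gt0 hc] := coord_pnorm_bound.
exists (\sum_k c * enorm (L *m delta_mx k 0)) => _ [x /= x1 <-].
rewrite [x in enorm (L *m x)]col_delta_sum mulmx_sumr.
apply: le_trans (is_norm_sum enorm_is_norm _ _) _; apply: ler_sum => k _.
rewrite -scalemxAr enormZ ler_wpM2r ?enorm_ge0 //.
by apply: le_trans (hc x k) _; rewrite ler_piMr // ltW.
Qed.

Lemma enorm_le_opnorm L x : enorm (L *m x) <= opnorm nu L * pnorm nu x.
Proof.
have := pnorm_ge0 x; rewrite le_eqVlt => /predU1P[x0|x_gt0].
  have [c _ /(_ x) hc] := coord_pnorm_bound.
  have -> : x = 0.
    apply/colP => k; rewrite mxE; apply/eqP; rewrite -normr_le0.
    by rewrite (le_trans (hc k)) // -x0 mulr0.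
  by rewrite mulmx0 enorm0 pnorm0 mulr0.
rewrite -ler_pdivrMr // mulrC.
have := ub_le_sup (opnorm_has_sup L).2; apply.
exists ((pnorm nu x)^-1 *: x); last first.
  by rewrite -scalemxAr enormZ ger0_norm // invr_ge0 ltW.
by rewrite /= pnormZ ger0_norm ?mulVf ?gt_eqF // invr_ge0 ltW.
Qed.

(** Otherwise the image of each unit vector has norm zero, so every column of [L] vanishes. *)
Lemma opnorm_gt0 L : L != 0 -> 0 < opnorm nu L.
Proof.
move=> L0; rewrite ltNge; apply: contra L0 => nL_le0.
apply/eqP/matrixP => i j; rewrite mxE.
have /eqP : enorm (L *m delta_mx j 0) = 0.
  apply/eqP; rewrite eq_le enorm_ge0 andbT.
  by apply: le_trans (enorm_le_opnorm _ _) _; rewrite mulr_le0_ge0 ?pnorm_ge0.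
move=> /eqP /(norm_definite enorm_is_norm) /colP /(_ i).
by rewrite -colE !mxE.
Qed.

End OperatorNorm.

(** * Symmetry and nonvanishing of the Laplacian *)

Section Laplacian.
Context {R : realType} {m : nat}.
Implicit Types (e : rel 'I_m).

Lemma trmx_biglaplacian d e :
  symmetric e -> (biglaplacian d e : 'M[R]_(m * d))^T = biglaplacian d e.
Proof.
move=> e_sym; rewrite /biglaplacian trmx_tens trmx1; congr (_ *t _).
apply/matrixP => i j; rewrite !mxE eq_sym e_sym.
by case: eqP => // ->.
Qed.

(** The first edge of a path without repetitions will do; the absence of repetitions excludes a loop
    at [i]. *)
Lemma connected_neighbour e (i j : 'I_m) :
  connect e i j -> i != j -> exists2 k, e i k & k != i.
Proof.
case/connectP => p; case/shortenP => -[|k q] /=.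
  by move=> _ _ _ ->; rewrite eqxx.
case/andP => eik _ /andP[]; rewrite inE negb_or eq_sym => /andP[ki _] _ _ _ _.
by exists k.
Qed.

(** Vertex 0 has a neighbour, and that edge gives an off-diagonal entry -1. *)
Lemma biglaplacian_neq0 d e : (2 <= m)%N -> (1 <= d)%N ->
  (forall i j, connect e i j) -> (biglaplacian d e : 'M[R]_(m * d)) != 0.
Proof.
move=> hm hd e_conn; have m_gt0 := ltnW hm.
have [k eik ki] := connected_neighbour
  (e_conn (Ordinal m_gt0) (Ordinal hm)) isT.
apply/eqP => /matrixP.
move=> /(_ (mxtens_index (Ordinal m_gt0, Ordinal hd))
           (mxtens_index (k, Ordinal hd))).
rewrite tensmxE !mxE eq_sym (negbTE ki) eik eqxx mulr1 => /eqP.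
by rewrite oppr_eq0 oner_eq0.
Qed.

End Laplacian.

(** * Convex combinations *)

Lemma convex_set_mem {R : realType} {n : nat} (X : set 'cV[R]_n) :
  convex_set X -> forall x y (t : R), X x -> X y -> 0 <= t <= 1 ->
  X (t *: x + (1 - t) *: y).
Proof.
move=> cX x y t Xx Xy /andP[t0 t1].
pose l := Itv01 t0 t1.
by have := cX x y l (mem_set Xx) (mem_set Xy); rewrite inE.
Qed.

(** Induction on the number of points: the new mean combines the old one, of total weight [A], and
    the last point, with coefficient [A / (A + a T.+2)] on the former. *)
Lemma convex_weighted_mean {R : realType} {n : nat} (X : set 'cV[R]_n)
    (a : nat -> R) (u : nat -> 'cV[R]_n) (T : nat) :
  convex_set X -> (1 <= T)%N ->
  (forall t, (1 <= t <= T)%N -> 0 < a t) ->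
  (forall t, (1 <= t <= T)%N -> X (u t)) ->
  X ((\sum_(1 <= t < T.+1) a t)^-1 *: \sum_(1 <= t < T.+1) a t *: u t).
Proof.
move=> cX; elim: T => // -[|T] IH _ a_gt0 Xu.
  rewrite !big_nat1 scalerA mulVf ?scale1r; first exact: Xu.
  by rewrite gt_eqF ?a_gt0.
rewrite !(big_nat_recr T.+2) //=.
set A := \sum_(1 <= t < T.+2) a t; set U := \sum_(1 <= t < T.+2) a t *: u t.
have A_gt0 : 0 < A.
  rewrite /A big_nat_recr //= ltr_wpDl ?a_gt0 ?leqnSn //.
  rewrite big_nat_cond; apply: sumr_ge0 => t ht; rewrite ltW // a_gt0 //; lia.
have aT : 0 < a T.+2 by rewrite a_gt0 ?leqnn.
have XU : X (A^-1 *: U).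
  by apply: IH => // t ht; [apply: a_gt0 | apply: Xu]; lia.
have XT : X (u T.+2) by apply: Xu; rewrite leqnn.
have -> : (A + a T.+2)^-1 *: (U + a T.+2 *: u T.+2) =
    (A / (A + a T.+2)) *: (A^-1 *: U) + (1 - A / (A + a T.+2)) *: u T.+2.
  have S0 : A + a T.+2 != 0 by rewrite gt_eqF // addr_gt0.
  rewrite scalerDr !scalerA; congr (_ *: _ + _ *: _).
    by field; rewrite S0 gt_eqF.
  by field.
apply: convex_set_mem => //.
have S_gt0 : 0 < A + a T.+2 by rewrite addr_gt0.
by rewrite ler_pdivrMr // mul1r lerDl !ltW // divr_gt0.
Qed.

(** * Bregman distances: three-point identity and quadratic lower bound *)

Section Prox.
Context {R : realType} {n : nat} (X : set 'cV[R]_n) (nu : 'cV[R]_n -> R)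
  (omega : 'cV[R]_n -> R) (g : 'cV[R]_n -> 'cV[R]_n).
Hypotheses (cX : convex_set X) (nuN : is_norm nu) (omega_C1 : C1_on X omega g).
Local Notation V := (prox omega g).
Implicit Types (x u v p q : 'cV[R]_n) (s t : R).

Lemma prox_three_point p q v :
  V p v = V p q + V q v + dotp (g q - g p) (v - q).
Proof.
rewrite /prox dotpDl dotpNl.
have -> : v - p = (v - q) + (q - p) by rewrite addrA subrK.
by rewrite dotpDr; ring.
Qed.

Lemma segment_mem x u t : X x -> X u -> 0 <= t <= 1 -> X (x + t *: (u - x)).
Proof.
move=> Xx Xu t01; have := convex_set_mem cX Xu Xx t01.
by rewrite scalerBl scale1r scalerBr addrCA addrA.
Qed.

(** Restricts the expansion in [C1_on] to a segment of [X]. Dividing [eps] by [enorm (u - x) + 1]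
    absorbs the length of the segment and also covers u = x. *)
Lemma segment_first_order x u t (eps : R) :
  X x -> X u -> 0 <= t <= 1 -> 0 < eps ->
  exists2 del : R, 0 < del & forall s, 0 <= s <= 1 -> `|s - t| < del ->
    `|omega (x + s *: (u - x)) - omega (x + t *: (u - x))
      - (s - t) * dotp (g (x + t *: (u - x))) (u - x)| <= eps * `|s - t|.
Proof.
move=> Xx Xu t01 eps_gt0; pose z (s : R) := x + s *: (u - x).
have zB s : z s - z t = (s - t) *: (u - x).
  by rewrite /z opprD addrACA subrr add0r scalerBl.
have E_gt0 : 0 < enorm (u - x) + 1 by rewrite ltr_wpDl ?enorm_ge0.
have zc : z s @[s --> t] --> z t.
  by apply: cvgD; [exact: cvg_cst | exact: scalel_continuous].
have := omega_C1.2 (z t) (segment_mem Xx Xu t01) _ (divr_gt0 eps_gt0 E_gt0).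
move=> /zc /nbhs_ballP[del /= del_gt0 h]; exists del => // s s01 st.
have /h/= /(_ (segment_mem Xx Xu s01)) : ball t del s.
  by rewrite -ball_normE /= distrC.
rewrite zB dotpZr enormZ => /le_trans; apply.
rewrite mulrCA mulrC ler_wpM2r // mulrAC ler_pdivrMr // ler_pM2l //.
by rewrite lerDl.
Qed.

(* Along the segment the prox function minus its quadratic lower bound has the
   derivative <g(z) - g(x), u - x> - t nu(u - x)^2, nonnegative by monotonicity. *)
Lemma prox_ge x u :
  (forall p q, X p -> X q -> nu (p - q) ^+ 2 <= dotp (g p - g q) (p - q)) ->
  X x -> X u -> nu (u - x) ^+ 2 / 2 <= V x u.
Proof.
move=> g_mono Xx Xu; pose z s := x + s *: (u - x).
pose b s := dotp (g (z s)) (u - x); pose n2 := nu (u - x) ^+ 2.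
pose phi (s : R) := omega (z s).
(* The first-order bound with error factor 1 gives |phi s - phi t| <= (|b t| + 1) |s - t| near t. *)
have phi_cont : {within `[0, 1], continuous phi}.
  apply/subspace_continuousP => t; rewrite /= in_itv /= => t01.
  apply/cvgrPdist_le => eps eps_gt0; rewrite near_withinE.
  have [del del_gt0 h] := segment_first_order Xx Xu t01 ltr01.
  have b_gt0 : 0 < `|b t| + 1 by rewrite ltr_wpDl.
  have e_gt0 : 0 < Num.min del (eps / (`|b t| + 1)).
    by rewrite lt_min del_gt0 divr_gt0.
  apply/nbhs_ballP; exists (Num.min del (eps / (`|b t| + 1))) => //= s.
  rewrite -ball_normE /= in_itv /= distrC lt_min => /andP[st1 st2] s01.
  have := h s s01 st1; rewrite -/(z s) -/(z t) -/(b t) -/(phi s) -/(phi t) mul1r.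
  move=> h1; rewrite distrC -(subrK ((s - t) * b t) (phi s - phi t)).
  apply: le_trans (ler_normD _ _) _; rewrite normrM.
  move: st2; rewrite ltr_pdivlMr // mulrDr mulr1 => st2; lra.
have phi_drv t : t \in `]0, 1[%R -> is_derive t 1 phi (b t).
  rewrite in_itv /= => /andP[t0 t1].
  suff H : h^-1 *: ((phi \o shift t) (h *: 1) - phi t) @[h --> 0^'] --> b t.
    by apply: DeriveDef; [apply/cvg_ex; exists (b t) | exact: cvg_lim].
  apply/cvgrPdist_le => eps eps_gt0.
  have t01 : 0 <= t <= 1 by rewrite !ltW.
  have [del del_gt0 hd] := segment_first_order Xx Xu t01 eps_gt0.
  near=> h.
  have h0 : h != 0 by near: h; exact: nbhs_dnbhs_neq.
  have h1 : `|h| < del by near: h; exact: dnbhs0_lt.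
  have h2 : `|h| < t by near: h; exact: dnbhs0_lt.
  have h3 : `|h| < 1 - t by near: h; apply: dnbhs0_lt; rewrite subr_gt0.
  have s01 : 0 <= h + t <= 1.
    by move: h2 h3; rewrite !ltr_norml; lra.
  have := hd _ s01; rewrite addrK => /(_ h1).
  rewrite -/(z t) -/(b t) -/(z (h + t)) -/(phi (h + t)) -/(phi t) => H.
  rewrite /= [h *: 1]mulr1 distrC.
  have -> : h^-1 *: (phi (h + t) - phi t) - b t =
      h^-1 * (phi (h + t) - phi t - h * b t).
    by rewrite /GRing.scale /=; field.
  by rewrite normrM normfV mulrC ler_pdivrMr ?normr_gt0.
(* The claim is psi 1 >= psi 0, obtained from the mean value theorem at a point [c] where the
   derivative is nonnegative. *)
pose psi s := phi s - (s * b 0 + s ^+ 2 / 2 * n2).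
have psi_cont : {within `[0, 1], continuous psi}.
  apply/subspace_continuousP => t t01; apply: cvgB.
    by move/subspace_continuousP: phi_cont; exact.
  apply: cvg_within_filter; apply: cvgD.
    by apply: cvgMl; exact: cvg_id.
  apply: cvgMl; apply: cvgMl; exact: exprn_continuous.
have q_drv t : is_derive t 1 (fun s : R => s * b 0 + s ^+ 2 / 2 * n2) (b 0 + t * n2).
  by apply: is_derive_eq; rewrite /GRing.scale /=; field.
have psi_drv t : t \in `]0, 1[%R -> is_derive t 1 psi (b t - (b 0 + t * n2)).
  move=> /phi_drv phi_drv_t.
  exact: is_deriveB.
have b0 : b 0 = dotp (g x) (u - x) by rewrite /b /z scale0r addr0.
have [c] := MVT ltr01 psi_drv psi_cont.
rewrite in_itv /= => /andP[c0 c1].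
rewrite subr0 mulr1 => E.
(* Since z c - x = c (u - x), monotonicity between [z c] and [x] is c times this bound. *)
have df_ge0 : 0 <= b c - (b 0 + c * n2).
  rewrite -(pmulr_rge0 _ c0).
  have c01 : 0 <= c <= 1 by rewrite !ltW.
  have := g_mono _ _ (segment_mem Xx Xu c01) Xx.
  rewrite addrAC subrr add0r (norm_scale nuN) gtr0_norm // exprMn dotpZr.
  rewrite dotpDl dotpNl -b0 -/(z c) -/(b c) -/n2; nra.
move: df_ge0; rewrite -E /psi /phi /z scale1r scale0r addr0 (addrC x) subrK.
rewrite /prox b0 -/n2 expr1n expr0n /= mul0r mul0r !mul1r.
lra.
Unshelve. all: by end_near.
Qed.
End Prox.

(* Jensen's inequality from a supporting hyperplane at the mean. *)
Lemma weighted_mean_le {R : realType} {n : nat} (a : nat -> R)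
    (u : nat -> 'cV[R]_n) (T : nat) (Psi : 'cV[R]_n -> R) (p : 'cV[R]_n) :
  let A := \sum_(1 <= t < T.+1) a t in
  let z := A^-1 *: \sum_(1 <= t < T.+1) a t *: u t in
  A != 0 -> (forall t, (1 <= t <= T)%N -> 0 <= a t) ->
  (forall t, (1 <= t <= T)%N -> Psi z + dotp p (u t - z) <= Psi (u t)) ->
  A * Psi z <= \sum_(1 <= t < T.+1) a t * Psi (u t).
Proof.
move=> A z A0 a_ge0 h.
have : \sum_(1 <= t < T.+1) a t * (Psi z + dotp p (u t - z))
    <= \sum_(1 <= t < T.+1) a t * Psi (u t).
  by apply: ler_sum_nat => t ht; rewrite ler_wpM2l ?a_ge0 ?h.
congr (_ <= _).
under eq_bigr do rewrite mulrDr.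
rewrite big_split /= -mulr_suml -/A.
suff -> : \sum_(1 <= t < T.+1) a t * dotp p (u t - z) = 0 by rewrite addr0.
under eq_bigr do rewrite -dotpZr scalerBr.
rewrite -dotp_sumr sumrB -scaler_suml -/A /z scalerA divff // scale1r subrr.
exact: dotp0r.
Qed.

(** * The inner loop of one agent *)

Section InnerLoop.
Context {R : realType} {n : nat} (X : set 'cV[R]_n) (nu : 'cV[R]_n -> R)
  (omega : 'cV[R]_n -> R) (g : 'cV[R]_n -> 'cV[R]_n).
Hypotheses (cX : convex_set X) (nuN : is_norm nu) (omega_C1 : C1_on X omega g).
Hypothesis g_mono :
  forall p q, X p -> X q -> nu (p - q) ^+ 2 <= dotp (g p - g q) (p - q).
Local Notation V := (prox omega g).
Implicit Types (x u v p q : 'cV[R]_n).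

Lemma prox_ge0 x u : X x -> X u -> 0 <= V x u.
Proof.
move=> Xx Xu; apply: le_trans (prox_ge cX nuN omega_C1 g_mono Xx Xu).
by rewrite divr_ge0 ?sqr_ge0.
Qed.

(** First-order optimality of [u] along the segment towards [v]; the three-point identity converts
    the gradient terms into Bregman terms. *)
Lemma prox_step (c x p u v : 'cV[R]_n) (eta eta' : R) :
  0 <= eta -> 0 <= eta' ->
  is_argmin X (fun z => dotp c z + eta * V x z + eta' * V p z) u -> X v ->
  dotp c (u - v) + eta * V x u + eta' * V p u
    <= eta * V x v + eta' * V p v - (eta + eta') * V u v.
Proof.
move=> eta_ge0 eta'_ge0 [Xu u_min] Xv.
suff : 0 <= dotp c (v - u) + eta * dotp (g u - g x) (v - u)
         + eta' * dotp (g u - g p) (v - u).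
  rewrite (prox_three_point omega g x u v) (prox_three_point omega g p u v).
  by rewrite -(opprB v u) dotpNr; lra.
set A := leRHS; rewrite leNgt; apply/negP => A_lt0.
have K_gt0 : 0 < eta + eta' + 1 by rewrite ltr_wpDl ?addr_ge0.
(* Small enough that A + (eta + eta') eps stays negative; the added 1 covers eta + eta' = 0. *)
pose eps := - A / (2 * (eta + eta' + 1)).
have eps_gt0 : 0 < eps by rewrite divr_gt0 ?oppr_gt0 ?mulr_gt0.
have t01 : 0 <= (0 : R) <= 1 by rewrite lexx ler01.
have [del del_gt0 h] := segment_first_order cX omega_C1 Xu Xv t01 eps_gt0.
pose s := Num.min 1 (del / 2).
have s_gt0 : 0 < s by rewrite lt_min ltr01 divr_gt0.
have s_le1 : s <= 1 by rewrite ge_min lexx.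
have s01 : 0 <= s <= 1 by rewrite ltW.
have s_del : `|s - 0| < del.
  rewrite subr0 gtr0_norm // (@le_lt_trans _ _ (del / 2)) ?ge_min ?lexx ?orbT //.
  by rewrite ltr_pdivrMr // ltr_pMr ?ltr1n.
have {h} := h s s01 s_del.
have := u_min _ (segment_mem cX Xu Xv s01).
rewrite subr0 (gtr0_norm s_gt0) scale0r addr0 => opt.
rewrite ler_norml => /andP[_ h].
have : 0 <= s * (A + (eta + eta') * eps).
  move: opt h; rewrite /A /prox.
  have -> : u + s *: (v - u) - x = (u - x) + s *: (v - u) by rewrite addrAC.
  have -> : u + s *: (v - u) - p = (u - p) + s *: (v - u) by rewrite addrAC.
  rewrite !dotpE => opt h.
  have K_ge0 : 0 <= eta + eta' by rewrite addr_ge0.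
  have := ler_wpM2l K_ge0 h; move: opt; lra.
rewrite pmulr_rge0 // leNgt => /negP; apply.
have -> : A + (eta + eta') * eps = A / 2 * ((eta + eta' + 2) / (eta + eta' + 1)).
  by rewrite /eps; field; rewrite gt_eqF.
rewrite pmulr_llt0; first by rewrite pmulr_llt0.
by rewrite divr_gt0 // ltr_wpDl ?addr_ge0.
Qed.

Context (M : R) (f : 'cV[R]_n -> R) (f' : 'cV[R]_n -> 'cV[R]_n).
Hypothesis f'_sub : forall y, X y -> subdifferential X f y (f' y).
Hypothesis f'_bounds : subgradient_bounds X nu 0 M f f'.

(** The linear term is split at [p]: the subgradient inequality handles v - p, and the upper bound
    with [M] handles u - p. *)
Lemma prox_subgradient_step (w x p u v : 'cV[R]_n) (eta b : R) :
  0 < eta -> 0 < b -> X p -> X v ->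
  is_argmin X
    (fun z => dotp (w + f' p) z + eta * V x z + eta * (b / 2) * V p z) u ->
  dotp w (u - v) + f u - f v + eta * V x u - eta * V x v
    + eta * (1 + b / 2) * V u v
  <= eta * (b / 2) * V p v + M ^+ 2 / (eta * b).
Proof.
move=> eta_gt0 b_gt0 Xp Xv u_min; have Xu := u_min.1.
have eb_gt0 : 0 < eta * b by rewrite mulr_gt0.
have eb2_ge0 : 0 <= eta * (b / 2) by rewrite ltW // mulr_gt0 // divr_gt0.
have := prox_step (ltW eta_gt0) eb2_ge0 u_min Xv.
rewrite dotpDl; have -> : dotp (f' p) (u - v) =
    dotp (f' p) (u - p) - dotp (f' p) (v - p).
  by rewrite -dotpNr -dotpDr opprB addrA subrK.
have /andP[_] := f'_bounds Xu Xp.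
have := f'_sub Xp Xv.
have : eta * (b / 2) * (nu (u - p) ^+ 2 / 2) <= eta * (b / 2) * V p u.
  by rewrite ler_wpM2l //; exact: (prox_ge cX).
(* Completing the square; the quadratic term is exactly what [V p u] absorbs. *)
have : M * nu (u - p) <= eta * b / 4 * nu (u - p) ^+ 2 + M ^+ 2 / (eta * b).
  rewrite -subr_ge0.
  have -> : eta * b / 4 * nu (u - p) ^+ 2 + M ^+ 2 / (eta * b) - M * nu (u - p)
    = (eta * b) / 4 * (nu (u - p) - 2 * M / (eta * b)) ^+ 2.
    by field; rewrite !gt_eqF.
  by rewrite mulr_ge0 ?sqr_ge0 // divr_ge0 // ltW.
lra.
Qed.

(** Jensen carries the summed steps over to the weighted mean. With A = T(T+3)/2 the total weight,
    the factor of the Bregman difference is eta (A+1)/A: [V x v] collects A from the prox terms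
    centred at [x] and 1 from the initial point. *)
Lemma inner_loop (w x v : 'cV[R]_n) (u : nat -> 'cV[R]_n) (eta : R) (T : nat) :
  let a t : R := t%:R + 1 in
  let xh := (\sum_(1 <= t < T.+1) a t)^-1 *: \sum_(1 <= t < T.+1) a t *: u t in
  (1 <= T)%N -> 0 < eta -> X x -> X v -> u 0%N = x ->
  (forall t, (1 <= t <= T)%N ->
     is_argmin X (fun z => dotp (w + f' (u t.-1)) z + eta * V x z
                           + eta * (t%:R / 2) * V (u t.-1) z) (u t)) ->
  X xh /\
  dotp w (xh - v) + f xh - f v + eta * V x xh
    <= eta * (1 + 2 / (T%:R * (T%:R + 3))) * (V x v - V (u T) v)
       + 4 * M ^+ 2 / (eta * T%:R).
Proof.
move=> a xh T_gt0 eta_gt0 Xx Xv u0 u_min.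
have Xu t : (t <= T)%N -> X (u t).
  case: t => [|t] tT; first by rewrite u0.
  by apply: (u_min t.+1 _).1; rewrite tT.
have a_gt0 t : 0 < a t by rewrite ltr_wpDl.
have sumA k : \sum_(1 <= t < k.+1) a t = k%:R * (k%:R + 3) / 2.
  elim: k => [|k IH]; first by rewrite big_geq // !mul0r.
  by rewrite big_nat_recr //= IH /a -natr1; field.
set A := \sum_(1 <= t < T.+1) a t in xh *.
have T0 : (0 : R) < T%:R by rewrite ltr0n.
have AE : A = T%:R * (T%:R + 3) / 2 := sumA T.
have A_gt0 : 0 < A by rewrite AE divr_gt0 // mulr_gt0 // addr_gt0.
have Xxh : X xh by apply: convex_weighted_mean => // t /andP[_]; exact: Xu.
split => //.
pose S z := dotp w (z - v) + f z - f v + eta * V x z - eta * V x v.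
have jensen : A * S xh <= \sum_(1 <= t < T.+1) a t * S (u t).
  (* The slope of a supporting hyperplane of [S] at [xh]: the remainder is that of [f] plus eta
     V(xh, u t), both nonnegative. *)
  apply: (@weighted_mean_le _ _ a u T S
           (w + f' xh + eta *: (g xh - g x))); first by rewrite gt_eqF.
    by move=> t _; rewrite ltW.
  move=> t /andP[_ tT]; rewrite -/A -/xh /S.
  have := f'_sub Xxh (Xu t tT).
  have : 0 <= eta * V xh (u t) by rewrite mulr_ge0 ?prox_ge0 ?ltW //; exact: Xu.
  rewrite (prox_three_point omega g x xh (u t)).
  rewrite !dotpE. lra.
have steps k : (k <= T)%N ->
    \sum_(1 <= t < k.+1) a t * S (u t)
      + eta * ((k%:R + 1) * (k%:R + 2) / 2) * V (u k) v
    <= eta * V x v + 2 * k%:R * M ^+ 2 / eta.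
  elim: k => [|k IH] kT.
    by rewrite big_geq // u0 !(mul0r, mulr0, add0r, addr0) mul1r divff ?mulr1.
  have {IH} := IH (ltnW kT); rewrite [in X in _ -> X]big_nat_recr //=.
  have b_gt0 : (0 : R) < k.+1%:R by rewrite ltr0n.
  have := prox_subgradient_step eta_gt0 b_gt0 (Xu k (ltnW kT)) Xv (u_min k.+1 kT).
  rewrite -/(S (u k.+1)).
  rewrite -(ler_pM2l (a_gt0 k.+1)) => h1 h2.
  (* The ratio (k+2)/(k+1) of weight to index is at most 2. *)
  have h3 : a k.+1 * (M ^+ 2 / (eta * k.+1%:R)) <= 2 * M ^+ 2 / eta.
    have -> : a k.+1 * (M ^+ 2 / (eta * k.+1%:R))
        = (a k.+1 / k.+1%:R) * (M ^+ 2 / eta).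
      by field; rewrite !gt_eqF.
    rewrite -(mulrA 2); apply: ler_wpM2r; first by rewrite divr_ge0 ?sqr_ge0 // ltW.
    by rewrite ler_pdivrMr // /a mulrDl mul1r lerD2l ler1n.
  move: h1 h2 h3; rewrite /a -(natr1 k) => h1 h2 h3.
  lra.
have M_ge0 : 0 <= M ^+ 2 / eta by rewrite divr_ge0 ?sqr_ge0 // ltW.
rewrite -(ler_pM2l A_gt0).
(* After scaling by [A] the allowed error 2(T+3) M^2/eta dominates the accumulated 2T M^2/eta. *)
have -> : A * (eta * (1 + 2 / (T%:R * (T%:R + 3))) * (V x v - V (u T) v)
               + 4 * M ^+ 2 / (eta * T%:R))
    = eta * (A + 1) * (V x v - V (u T) v) + 2 * (T%:R + 3) * (M ^+ 2 / eta).
  by rewrite AE; field; rewrite !gt_eqF // addr_gt0.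
have := steps T (leqnn T); move: jensen.
have -> : (T%:R + 1) * (T%:R + 2) / 2 = A + 1 by rewrite AE; field.
rewrite /S.
lra.
Qed.
End InnerLoop.

(* Telescoping of the dual extrapolation: [l k] is L xhat^k and [del k] is
   L (xhat^k - x^(k-1)), so the bracket is L xtilde^k. *)
Lemma dual_telescope {R : realType} {n : nat} (c : R) (N : nat)
    (y l del : nat -> 'cV[R]_n) (z : 'cV[R]_n) :
  0 < c -> del 0%N = 0 ->
  (forall k, (1 <= k <= N)%N ->
     y k = y k.-1 + c^-1 *: (l k - del k + del k.-1)) ->
  \sum_(1 <= k < N.+1) dotp (l k) (z - y k)
    <= c / 2 * enorm (z - y 0%N) ^+ 2
       + \sum_(1 <= k < N.+1) enorm (del k) ^+ 2 / (2 * c).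
Proof.
move=> c_gt0 del0 y_rec.
have young (u v : 'cV[R]_n) :
    dotp u v <= enorm u ^+ 2 / (2 * c) + c / 2 * enorm v ^+ 2.
  have c2 : 0 < 2 * c by rewrite mulr_gt0.
  rewrite !enorm_sqr.
  have -> : dotp u u / (2 * c) + c / 2 * dotp v v
      = (dotp u u + c ^+ 2 * dotp v v) / (2 * c) by field; rewrite gt_eqF.
  by rewrite ler_pdivlMr // mulrC dotp_young.
(* The invariant leaves [del k] paired with [z - y k]. At k = N Young's inequality cancels this
   pairing against the negative square and adds the error term of index N. *)
suff main k : (k <= N)%N ->
    \sum_(1 <= j < k.+1) dotp (l j) (z - y j)
      <= c / 2 * enorm (z - y 0%N) ^+ 2 - c / 2 * enorm (z - y k) ^+ 2
         + dotp (del k) (z - y k)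
         + \sum_(0 <= j < k) enorm (del j) ^+ 2 / (2 * c).
  have := main N (leqnn N); have := young (del N) (z - y N).
  have : \sum_(0 <= j < N.+1) enorm (del j) ^+ 2 / (2 * c)
       = \sum_(1 <= k < N.+1) enorm (del k) ^+ 2 / (2 * c).
    by rewrite big_ltn // del0 enorm0 expr0n mul0r add0r.
  by rewrite big_nat_recr //=; lra.
elim: k => [|k IH] kN.
  by rewrite !big_geq // del0 dotp0l; lra.
have {IH} := IH (ltnW kN); rewrite (big_nat_recr k.+1) //= (big_nat_recr k 0%N) //=.
(* Polarization of <y k.+1 - y k, z - y k.+1> yields the telescoping squares and a negative square
   of the dual step, which absorbs <del k, y k.+1 - y k>. *)
have lE : l k.+1 = c *: (y k.+1 - y k) + del k.+1 - del k.
  rewrite (y_rec k.+1) //= (addrC (y k)) addrK scalerA divff ?gt_eqF // scale1r.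
  by rewrite [_ + del k + _]addrAC subrK addrK.
have := young (del k) (y k.+1 - y k).
rewrite lE !enorm_sqr !dotpE (dotpC (y k.+1) z) (dotpC (y k) z) (dotpC (y k) (y k.+1)).
lra.
Qed.

(** * Gap estimate for a full run *)

Section Run.
Context {R : realType} {m d : nat} (X : 'I_m -> set 'cV[R]_d)
  (nu : 'I_m -> 'cV[R]_d -> R) (M : R)
  (f : 'I_m -> 'cV[R]_d -> R) (f' : 'I_m -> 'cV[R]_d -> 'cV[R]_d)
  (omega : 'I_m -> 'cV[R]_d -> R) (gomega : 'I_m -> 'cV[R]_d -> 'cV[R]_d)
  (L : 'M[R]_(m * d)).
Hypotheses (X_convex : forall i, convex_set (X i))
  (nu_norm : forall i, is_norm (nu i))
  (f'_sub : forall i y, X i y -> subdifferential (X i) (f i) y (f' i y))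
  (f'_bounds : forall i, subgradient_bounds (X i) (nu i) 0 M (f i) (f' i))
  (omega_C1 : forall i, C1_on (X i) (omega i) (gomega i))
  (omega_mono : forall i x u, X i x -> X i u ->
     nu i (x - u) ^+ 2 <= dotp (gomega i x - gomega i u) (x - u))
  (L_sym : L^T = L).
Local Notation nL := (opnorm nu L).
Local Notation V := (fun i => prox (omega i) (gomega i)).
Local Notation F := (Fsum f).
Hypothesis nL_gt0 : 0 < nL.

Lemma Vsum_ge0 x u : prodset X x -> prodset X u -> 0 <= Vsum V x u.
Proof.
move=> Xx Xu; apply: sumr_ge0 => i _.
exact: (prox_ge0 (@X_convex i) (nu_norm i) (omega_C1 i) (@omega_mono i) (Xx i) (Xu i)).
Qed.

Lemma pnorm_le_Vsum x u : prodset X x -> prodset X u ->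
  pnorm nu (u - x) ^+ 2 / 2 <= Vsum V x u.
Proof.
move=> Xx Xu; rewrite pnorm_sqr mulr_suml; apply: ler_sum => i _.
rewrite blkD blkN.
exact: (prox_ge (@X_convex i) (nu_norm i) (omega_C1 i) (@omega_mono i) (Xx i) (Xu i)).
Qed.

Lemma Fsum_mean_le (N : nat) (xhat : nat -> 'cV[R]_(m * d)) : (1 <= N)%N ->
  (forall k, (1 <= k <= N)%N -> prodset X (xhat k)) ->
  let z := N%:R^-1 *: \sum_(1 <= k < N.+1) xhat k in
  prodset X z /\ N%:R * F z <= \sum_(1 <= k < N.+1) F (xhat k).
Proof.
move=> hN Xxh z.
have zE i : blk z i = (\sum_(1 <= k < N.+1) (1 : R))^-1 *:
    \sum_(1 <= k < N.+1) (1 : R) *: blk (xhat k) i.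
  rewrite /z blkZ blk_sum sumr_const_nat subSS subn0.
  by congr (_ *: _); apply: eq_bigr => k _; rewrite scale1r.
have Xz : prodset X z.
  move=> i; rewrite zE; apply: (convex_weighted_mean (a := fun=> 1)) => //.
  by move=> k hk; exact: Xxh.
split => //; rewrite /Fsum exchange_big big_distrr /=; apply: ler_sum => i _.
have sum1 : \sum_(1 <= k < N.+1) (1 : R) = N%:R.
  by rewrite sumr_const_nat subSS subn0.
have := @weighted_mean_le R d (fun=> 1) (fun k => blk (xhat k) i) N (f i)
  (f' i (blk z i)).
rewrite /= -zE sum1 pnatr_eq0 -lt0n => /(_ hN (fun _ _ => ler01)) h.
under [leRHS]eq_bigr do rewrite -[f i _]mul1r.
by apply: h => k hk; apply: f'_sub => //; exact: Xxh.
Qed.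

Variables (N : nat) (Dt : R) (T : nat -> nat)
  (x xhat y : nat -> 'cV[R]_(m * d)) (u : 'I_m -> nat -> nat -> 'cV[R]_d).
Hypotheses (Dt_gt0 : 0 < Dt) (hN : (1 <= N)%N) (M_gt0 : 0 < M) (m_gt0 : (0 < m)%N).
Hypothesis hT : forall k, (1 <= k <= N)%N ->
     (T k)%:Z = Num.ceil (m%:R * M ^+ 2 * N%:R / (nL ^+ 2 * Dt)).
Hypothesis run : DCS L X f' V
     (fun=> 1) (fun=> nL) (fun=> 2 * nL) T
     (fun t => t%:R + 1) (fun t => t%:R / 2)
     N x xhat y u.

Lemma T_ge k : (1 <= k <= N)%N ->
  m%:R * M ^+ 2 * N%:R / (nL ^+ 2 * Dt) <= (T k)%:R.
Proof. by move=> hk; rewrite [leRHS]pmulrn -ceil_le_int (hT hk). Qed.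

Lemma T_gt0 k : (1 <= k <= N)%N -> (1 <= T k)%N.
Proof.
move=> hk; rewrite -(ltr_nat R); apply: lt_le_trans (T_ge hk).
by rewrite divr_gt0 // !mulr_gt0 ?ltr0n ?exprn_gt0.
Qed.

(** Gives every outer iteration the same Bregman factor, so that the sum over k telescopes. *)
Lemma T_const k : (1 <= k <= N)%N -> T k = T 1%N.
Proof.
have h1 : (1 <= 1 <= N)%N by rewrite hN.
by move=> hk; have := hT hk; rewrite -(hT h1) => -[].
Qed.

Lemma run_feasible k : (k <= N)%N -> prodset X (x k).
Proof.
case: k => [_|k kN i]; first exact: (DCS_init run).1.
have hk : (1 <= k.+1 <= N)%N by [].
have hT1 : (1 <= T k.+1 <= T k.+1)%N by rewrite leqnn T_gt0.
by rewrite (DCS_last run) //; have [] := DCS_inner run i hk hT1.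
Qed.

(** Sum of the inner-loop bounds over the agents with eta = 2|L|. The ceiling defining [T k] is what
    brings the total error 2 m M^2 / (|L| T) below 2 |L| Dt / N. *)
Lemma run_iteration k v : (1 <= k <= N)%N -> prodset X v ->
  prodset X (xhat k) /\
  dotp (L *m y k) (xhat k - v) + F (xhat k) - F v
    + 2 * nL * Vsum V (x k.-1) (xhat k)
  <= 2 * nL * (1 + 2 / ((T 1%N)%:R * ((T 1%N)%:R + 3)))
       * (Vsum V (x k.-1) v - Vsum V (x k) v)
     + 2 * nL * Dt / N%:R.
Proof.
move=> hk Xv; have Tk := T_gt0 hk.
have kN : (k.-1 <= N)%N by lia.
have nL2 : 0 < 2 * nL by rewrite mulr_gt0.
have agent i := inner_loop (@X_convex i) (nu_norm i) (omega_C1 i) (@omega_mono i)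
  (@f'_sub i) (@f'_bounds i) Tk nL2 (run_feasible kN i) (Xv i)
  (DCS_inner_init run i hk) (fun t ht => DCS_inner run i hk ht).
have {}agent i : X i (blk (xhat k) i) /\
    dotp (blk (L *m y k) i) (blk (xhat k - v) i) + f i (blk (xhat k) i)
      - f i (blk v i) + 2 * nL * V i (blk (x k.-1) i) (blk (xhat k) i)
    <= 2 * nL * (1 + 2 / ((T 1%N)%:R * ((T 1%N)%:R + 3)))
         * (V i (blk (x k.-1) i) (blk v i) - V i (blk (x k) i) (blk v i))
       + 4 * M ^+ 2 / (2 * nL * (T 1%N)%:R).
  have := agent i.
  by rewrite -(DCS_avg run i hk) -(DCS_last run i hk) (T_const hk) blkD blkN.
split=> [i|]; first exact: (agent i).1.
rewrite dotp_blk /Fsum /Vsum [2 * nL * \sum_i _]big_distrr /= -big_split -!sumrB.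
rewrite [in leRHS]big_distrr -big_split /=.
apply: le_trans (ler_sum _ (fun i _ => (agent i).2)) _.
rewrite big_split lerD2l sumr_const card_ord -[leLHS]mulr_natr -(T_const hk).
have T0 : 0 < (T k)%:R :> R by rewrite ltr0n.
have N0 : 0 < N%:R :> R by rewrite ltr0n.
have := T_ge hk; rewrite ler_pdivrMr ?mulr_gt0 ?exprn_gt0 // -subr_ge0 => T_large.
rewrite -subr_ge0.
have -> : 2 * nL * Dt / N%:R - 4 * M ^+ 2 / (2 * nL * (T k)%:R) * m%:R
    = 2 / (nL * (T k)%:R * N%:R)
      * ((T k)%:R * (nL ^+ 2 * Dt) - m%:R * M ^+ 2 * N%:R).
  by field; rewrite !gt_eqF.
by rewrite mulr_ge0 // divr_ge0 // ltW // !mulr_gt0.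
Qed.

Lemma run_gap xs z : prodset X xs -> L *m xs = 0 ->
  \sum_(1 <= k < N.+1) (F (xhat k) - F xs + dotp (L *m xhat k) z)
    <= 3 * nL * Vsum V (x 0%N) xs + nL / 2 * enorm (z - y 0%N) ^+ 2 + 2 * nL * Dt.
Proof.
move=> Xxs Lxs; have N0 : 0 < N%:R :> R by rewrite ltr0n.
pose rho : R := 2 / ((T 1%N)%:R * ((T 1%N)%:R + 3)).
have h1 : (1 <= 1 <= N)%N by rewrite hN.
(* T >= 1 gives T(T+3) >= 4; this turns the factor 2|L|(1 + rho) into 3|L|. *)
have rho_le : 1 + rho <= 3 / 2.
  have T1 : 1 <= (T 1%N)%:R :> R by rewrite ler1n T_gt0.
  have T3 : 0 < (T 1%N)%:R * ((T 1%N)%:R + 3) :> R.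
    by rewrite mulr_gt0 ?addr_gt0 ?(lt_le_trans ltr01).
  suff : rho <= 1 / 2 by lra.
  by rewrite /rho ler_pdivrMr //; nra.
have rho_ge0 : 0 <= rho by rewrite divr_ge0 // mulr_ge0 // addr_ge0.
(* With truncated predecessors [del 0] is L(xhat^0 - x^0) = 0, matching the initial condition x^(-1)
   = x^0. *)
pose del k := L *m (xhat k - x k.-1).
have del0 : del 0%N = 0 by rewrite /del (DCS_init run).2 subrr mulmx0.
have y_rec k : (1 <= k <= N)%N ->
    y k = y k.-1 + nL^-1 *: (L *m xhat k - del k + del k.-1).
  case: k => // k hk; rewrite (DCS_dual run hk) scale1r /del /= -!mulmxBr -mulmxDr.
  by rewrite subKr [x k + _]addrC.
have dual := dual_telescope z nL_gt0 del0 y_rec.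
have step k : (1 <= k <= N)%N ->
    F (xhat k) - F xs + dotp (L *m xhat k) z
    <= 2 * nL * (1 + rho) * (Vsum V (x k.-1) xs - Vsum V (x k) xs)
       + 2 * nL * Dt / N%:R
       + (dotp (L *m xhat k) (z - y k) - enorm (del k) ^+ 2 / (2 * nL)).
  move=> hk; have [Xxh] := run_iteration hk Xxs; rewrite -/rho.
  have kN : (k.-1 <= N)%N by lia.
  have hV := pnorm_le_Vsum (run_feasible kN) Xxh.
  (* The operator norm bound and the quadratic lower bound on V already give |L| V on the right. *)
  have hd : enorm (del k) ^+ 2 / (2 * nL) <= 2 * nL * Vsum V (x k.-1) (xhat k).
    rewrite ler_pdivrMr ?mulr_gt0 //.
    apply: (@le_trans _ _ ((nL * pnorm nu (xhat k - x k.-1)) ^+ 2)).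
      have nL_ge0 := ltW nL_gt0.
      rewrite ler_pXn2r ?nnegrE ?enorm_ge0 ?mulr_ge0 ?pnorm_ge0 //.
      exact: enorm_le_opnorm.
    have := ler_wpM2l (sqr_ge0 nL) hV.
    have := mulr_ge0 (sqr_ge0 nL) (sqr_ge0 (pnorm nu (xhat k - x k.-1))).
    rewrite exprMn; lra.
  (* Symmetry of [L] and L xs = 0 turn <L y^k, xhat^k - xs> into <L xhat^k, y^k>, which combines
     with the dual sum. *)
  rewrite (dotp_sym_mul _ _ L_sym) mulmxBr Lxs subr0 (dotpC (y k)).
  by rewrite dotpDr dotpNr; lra.
apply: le_trans; first by apply: ler_sum_nat => k hk; exact: (step k hk).
rewrite !big_split /= sumrN sumr_const_nat subSS subn0 -[_ *+ N]mulr_natr divfK ?gt_eqF //.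
rewrite -big_distrr /=.
have tel : \sum_(1 <= k < N.+1) (Vsum V (x k.-1) xs - Vsum V (x k) xs)
    = Vsum V (x 0%N) xs - Vsum V (x N) xs.
  rewrite big_add1 /= -opprB -(telescope_sumr (fun k => Vsum V (x k) xs)) // -sumrN.
  by apply: eq_bigr => k _; rewrite opprB.
rewrite tel.
have V0 := Vsum_ge0 (run_feasible (leq0n N)) Xxs.
have VN := Vsum_ge0 (run_feasible (leqnn N)) Xxs.
have c_ge0 : 0 <= 2 * nL * (1 + rho) by rewrite ltW // !mulr_gt0 // ltr_pwDl.
have := mulr_ge0 c_ge0 VN.
have : 2 * nL * (1 + rho) * Vsum V (x 0%N) xs <= 3 * nL * Vsum V (x 0%N) xs.
  by rewrite ler_wpM2r //; nra.
move: dual; lra.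
Qed.

Lemma run_mean_gap xs z : prodset X xs -> L *m xs = 0 ->
  let xavg := N%:R^-1 *: \sum_(1 <= k < N.+1) xhat k in
  prodset X xavg /\
  N%:R * (F xavg - F xs + dotp (L *m xavg) z)
    <= 3 * nL * Vsum V (x 0%N) xs + nL / 2 * enorm (z - y 0%N) ^+ 2 + 2 * nL * Dt.
Proof.
move=> Xxs Lxs xavg.
have Xxh k : (1 <= k <= N)%N -> prodset X (xhat k).
  by move=> hk; exact: (run_iteration hk Xxs).1.
have [Xavg hF] := Fsum_mean_le hN Xxh; split => //.
apply: le_trans (run_gap z Xxs Lxs).
rewrite big_split /= sumrB sumr_const_nat subSS subn0 mulrDr mulrBr (mulr_natl (F xs)).
have -> : N%:R * dotp (L *m xavg) z = \sum_(1 <= k < N.+1) dotp (L *m xhat k) z.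
  rewrite -dotpZl scalemxAr /xavg scalerA divff ?pnatr_eq0 -?lt0n // scale1r.
  by rewrite mulmx_sumr dotpC dotp_sumr; apply: eq_bigr => k _; rewrite dotpC.
by rewrite lerD2r lerD2r.
Qed.
End Run.

(** * From the gap estimate to the objective and feasibility bounds *)

Theorem theorem2 (R : realType) (m d : nat) (hm : (2 <= m)%N) (hd : (1 <= d)%N)
  (* the connected undirected graph *)
  (e : rel 'I_m) (e_sym : symmetric e) (e_conn : forall i j, connect e i j)
  (* the feasible sets and their norms *)
  (X : 'I_m -> set 'cV[R]_d)
  (X_closed : forall i, closed (X i)) (X_convex : forall i, convex_set (X i))
  (X_meet : (\bigcap_(i in [set: 'I_m]) X i) !=set0)
  (nu : 'I_m -> 'cV[R]_d -> R) (nu_norm : forall i, is_norm (nu i))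
  (* the objectives, with mu = 0 and M > 0 *)
  (M : R) (M_gt0 : 0 < M)
  (f : 'I_m -> 'cV[R]_d -> R) (f_convex : forall i, convex_function (X i) (f i))
  (f' : 'I_m -> 'cV[R]_d -> 'cV[R]_d)
  (f'_sub : forall i y, X i y -> subdifferential (X i) (f i) y (f' i y))
  (f'_bounds : forall i, subgradient_bounds (X i) (nu i) 0 M (f i) (f' i))
  (* the distance generating functions and their gradients *)
  (omega : 'I_m -> 'cV[R]_d -> R) (gomega : 'I_m -> 'cV[R]_d -> 'cV[R]_d)
  (omega_C1 : forall i, C1_on (X i) (omega i) (gomega i))
  (omega_mono : forall i x u, X i x -> X i u ->
     nu i (x - u) ^+ 2 <= dotp (gomega i x - gomega i u) (x - u))
  (L := biglaplacian d e : 'M[R]_(m * d)) (nL := opnorm nu L)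
  (V := fun i => prox (omega i) (gomega i)) (F := Fsum f)
  (* the optimal solution and the saddle point *)
  (xs ys : 'cV[R]_(m * d))
  (xs_opt : optimal_solution L X f xs) (xsys_saddle : saddle_point L X f xs ys)
  (* the parameters and the run of the method *)
  (N : nat) (hN : (1 <= N)%N) (Dt : R) (Dt_gt0 : 0 < Dt)
  (T : nat -> nat)
  (hT : forall k, (1 <= k <= N)%N ->
     (T k)%:Z = Num.ceil (m%:R * M ^+ 2 * N%:R / (nL ^+ 2 * Dt)))
  (x xhat y : nat -> 'cV[R]_(m * d)) (u : 'I_m -> nat -> nat -> 'cV[R]_d)
  (run : DCS L X f' V
     (fun=> 1) (fun=> nL) (fun=> 2 * nL) T
     (fun t => t%:R + 1) (fun t => t%:R / 2)
     N x xhat y u)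
  (xavg := N%:R^-1 *: \sum_(1 <= k < N.+1) xhat k) :
  F xavg - F xs
    <= nL / N%:R * (3 * Vsum V (x 0%N) xs + 2^-1 * enorm (y 0%N) ^+ 2 + 2 * Dt)
  /\
  enorm (L *m xavg)
    <= nL / N%:R * (3 * Num.sqrt (6 * Vsum V (x 0%N) xs + 4 * Dt)
                    + 4 * enorm (ys - y 0%N)).
Proof.
have m_gt0 : (0 < m)%N := ltnW hm.
have L_sym : L^T = L by exact: trmx_biglaplacian.
have nL_gt0 : 0 < nL by apply: opnorm_gt0 => //; exact: biglaplacian_neq0.
have N0 : 0 < N%:R :> R by rewrite ltr0n.
have [[Xxs /= Lxs] _] := xs_opt.
have gap z := run_mean_gap X_convex nu_norm f'_sub f'_bounds omega_C1 omega_mono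
  L_sym nL_gt0 Dt_gt0 hN M_gt0 m_gt0 hT run z Xxs Lxs.
have V_ge0 : 0 <= Vsum V (x 0%N) xs.
  exact: (Vsum_ge0 X_convex nu_norm omega_C1 omega_mono (DCS_init run).1 Xxs).
have Xavg : prodset X xavg := (gap 0).1.
split.
  have := (gap 0).2.
  rewrite -/xavg dotp0r addr0 sub0r (is_normN enorm_is_norm) => gap0.
  rewrite mulrAC ler_pdivlMr // mulrC (le_trans gap0) //.
  by rewrite -/nL -/V; lra.
have lagr : 0 <= F xavg - F xs + dotp (L *m xavg) ys.
  have /andP[_] := xsys_saddle.2 xavg ys Xavg.
  by rewrite Lxs dotp0l addr0 -/F; lra.
set w := L *m xavg in lagr *; set a := enorm (ys - y 0%N).
(* The part of the gap bound free of the multiplier is |L| B / 2. *)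
set B := 6 * Vsum V (x 0%N) xs + 4 * Dt.
have B_gt0 : 0 < B by rewrite /B; lra.
have a_ge0 : 0 <= a := enorm_ge0 _.
have sB_ge0 := sqrtr_ge0 B.
have := enorm_ge0 w; rewrite le_eqVlt => /predU1P[<-|w_gt0].
  by rewrite mulr_ge0 ?divr_ge0 ?addr_ge0 ?mulr_ge0 // ltW.
pose c := Num.sqrt (B + a ^+ 2).
have c2 : c ^+ 2 = B + a ^+ 2 by rewrite sqr_sqrtr // addr_ge0 ?sqr_ge0 ?(ltW B_gt0).
have c_gt0 : 0 < c by rewrite sqrtr_gt0 ltr_pwDl // sqr_ge0.
have c_le : c <= Num.sqrt B + a.
  rewrite -(@ler_pXn2r _ 2) ?nnegrE ?(ltW c_gt0) ?addr_ge0 //.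
  rewrite c2 sqrrD (sqr_sqrtr (ltW B_gt0)) lerD2r lerDl.
  by rewrite mulrn_wge0 // mulr_ge0.
(* The multiplier ys + c w/|w| trades the objective gap for the residual |w|;
   this c minimizes (B + (a + c)^2) / (2 c). *)
have := (gap (ys + (c / enorm w) *: w)).2.
rewrite -/xavg -/w dotpDr dotpZr -enorm_sqr expr2 mulrA divfK ?gt_eqF //.
set E := enorm (_ - y 0%N).
have E_le : E ^+ 2 <= (a + c) ^+ 2.
  rewrite ler_pXn2r ?nnegrE ?enorm_ge0 ?addr_ge0 ?(ltW c_gt0) //.
  rewrite /E addrAC; apply: le_trans (enormD _ _) _; rewrite lerD2l enormZ.
  have cw_ge0 : 0 <= c / enorm w by rewrite ltW // divr_gt0.
  by rewrite (ger0_norm cw_ge0) divfK ?gt_eqF.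
rewrite -/nL -/V -/F => gap_w.
(* The Lagrangian gap at [ys] is nonnegative and is dropped; c^2 = B + a^2 turns B + (a + c)^2 into
   2c(c + a). *)
have main : N%:R * (c * enorm w) <= nL * (c * (c + a)).
  have : 0 <= N%:R * (F xavg - F xs + dotp w ys) by rewrite mulr_ge0 ?(ltW N0).
  have : nL / 2 * E ^+ 2 <= nL / 2 * (a + c) ^+ 2.
    by rewrite ler_wpM2l // divr_ge0 // ltW.
  have : nL * (c * (c + a)) = nL / 2 * (c ^+ 2 + c ^+ 2) + nL * (c * a) by field.
  rewrite {1}c2 /B; move: gap_w; lra.
have {}main : N%:R * enorm w <= nL * (c + a).
  by rewrite -(ler_pM2l c_gt0); move: main; lra.
(* Here c + a <= sqrt B + 2a, well within 3 sqrt B + 4a. *)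
rewrite mulrAC ler_pdivlMr // mulrC (le_trans main) // ler_wpM2l ?(ltW nL_gt0) //.
by move: c_le; lra.
Qed.
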